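(* Let $\Phi$ be an $N$-function such that the function $u\mapsto\Phi(\sqrt{u})$ is convex on $[0,\infty)$. For any $n\in\mathbb{N}$, the system of direction cosines $\{\alpha_k\}_{k=1}^n$ on $S_n$ is the best lacunary system in the Orlicz space $L_\Phi(S_n)$, with the constant \[ C(\{\alpha_k\})=K_{\Phi,n}\sqrt{n},\qquad K_{\Phi,n}=\|\alpha_n\|_{L_\Phi(S_n)} . \]
   Context: An $N$-function is an even, convex and continuous function $\Phi:\mathbb{R}\to[0,\infty)$ such that $\Phi(0)=0$, $\Phi(u)>0$ for $u\neq 0$, $\lim_{u\to0}\Phi(u)/u=0$ and $\lim_{u\to\infty}\Phi(u)/u=\infty$. For a probability space $(E,\mathcal{A},\mu)$, the Orlicz space $L_\Phi(E)$ consists of all measurable functions $f:E\to\mathbb{R}$ for which there exists $\lambda>0$ with $\int_E\Phi(|f|/\lambda)\,d\mu<\infty$; it carries the Luxemburg norm \[ \|f\|_{L_\Phi(E)}=\inf\Big\{\lambda>0:\ \int_E\Phi\Big(\frac{|f|}{\lambda}\Big)\,d\mu\le 1\Big\}. \] Also $\|f\|_{L^2(E)}=\big(\int_E|f|^2\,d\mu\big)^{1/2}$. Functions equal $\mu$-almost everywhere are identified, so linear independence is understood modulo $\mu$-almost everywhere equality. $S_n=\{x\in\mathbb{R}^n:\ \sum_{k=1}^n x_k^2=1\}$ is the unit sphere in $\mathbb{R}^n$, equipped with the normalized surface measure $ds$ (the rotation-invariant probability measure). The system of direction cosines consists of the coordinate functions $\alpha_k(s)=x_k$ for $s=(x_1,\dots,x_n)\in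 S_n$, $1\le k\le n$. For a system $\{f_k\}_{k=1}^n\subset L_\Phi(E)\cap L^2(E)$ of linearly independent functions on a probability space $(E,\mathcal{A},\mu)$, $C(\{f_k\})$ denotes the smallest constant $M$ such that for all $a_1,\dots,a_n\in\mathbb{R}$ \[ \Big\|\sum_{k=1}^n a_kf_k\Big\|_{L_\Phi(E)}\le M\,\Big\|\sum_{k=1}^n a_kf_k\Big\|_{L^2(E)} . \] A system of $n$ linearly independent functions is called the best lacunary system (for given $\Phi$ and $n$) if its constant is minimal among all systems of $n$ linearly independent functions satisfying such an inequality, that is, $C(\{f_k\})\le C(\{h_k\})$ for every probability space $(E',\mathcal{A}',\mu')$ and every system $\{h_k\}_{k=1}^n\subset L_\Phi(E')\cap L^2(E')$ of linearly independent functions that satisfies such an inequality with some finite constant. *)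

(* Defs.v *)
From HB Require Import structures.
From mathcomp Require Import all_boot all_order all_algebra.
From mathcomp Require Import all_classical all_reals all_analysis measurable_realfun.

Set Implicit Arguments.
Unset Strict Implicit.
Unset Printing Implicit Defensive.

Import Order.TTheory GRing.Theory Num.Theory.
Import numFieldTopology.Exports numFieldNormedType.Exports.

Local Open Scope classical_set_scope.
Local Open Scope ring_scope.

Record N_function {R : realType} (Phi : R -> R) : Prop := {
  N_function_ge0 : forall u, 0 <= Phi u ;
  N_function_even : forall u, Phi (- u) = Phi u ;
  N_function_convex : convex_function [set: R^o] Phi ;
  N_function_continuous : continuous Phi ;
  N_function0 : Phi 0 = 0 ;
  N_function_gt0 : forall u, u != 0 -> 0 < Phi u ;
  N_function_cvg0 : Phi u / u @[u --> 0^'] --> 0 ;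
  N_function_cvgy : Phi u / u @[u --> +oo] --> +oo }.

Section function_spaces.
Context {R : realType} (Phi : R -> R).
Context {d : measure_display} {E : measurableType d} (mu : probability E R).

Definition Orlicz_space : set (E -> R) := [set f : E -> R |
  measurable_fun setT f /\
  exists2 l : R, 0 < l & (\int[mu]_x (Phi (`|f x| / l))%:E < +oo)%E].

(* Meaningful on [Orlicz_space], where the set is nonempty; [inf] is 0 on the
   empty set. *)
Definition Luxemburg_norm (f : E -> R) : R :=
  inf [set l : R | 0 < l /\ (\int[mu]_x (Phi (`|f x| / l))%:E <= 1)%E].

Definition L2_norm (f : E -> R) : R := fine 'N[mu]_2%:E[EFin \o f].

Definition lincomb n (f : 'I_n -> E -> R) (a : 'I_n -> R) : E -> R :=
  fun x => \sum_(k < n) a k * f k x.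

Definition ae_linearly_independent n (f : 'I_n -> E -> R) : Prop :=
  forall a : 'I_n -> R, lincomb f a = cst 0 %[ae mu] ->
  forall k, a k = 0.

Definition lacunary_bounds n (f : 'I_n -> E -> R) : set R := [set M |
  forall a : 'I_n -> R,
    Luxemburg_norm (lincomb f a) <= M * L2_norm (lincomb f a)].

Record lacunary_system n (f : 'I_n -> E -> R) : Prop := {
  lacunary_Orlicz : forall k, Orlicz_space (f k) ;
  lacunary_L2 : forall k, f k \in Lfun mu 2%:E ;
  lacunary_independent : ae_linearly_independent f ;
  lacunary_bounded : lacunary_bounds f !=set0 }.

(* For n > 0 and f a lacunary system this infimum is attained, i.e. it is the
   smallest admissible constant, see [lacunary_constantP]. *)
Definition lacunary_constant n (f : 'I_n -> E -> R) : R :=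
  inf (lacunary_bounds f).

End function_spaces.

Definition best_lacunary_system {R : realType} (Phi : R -> R)
    {d : measure_display} {E : measurableType d} (mu : probability E R)
    n (f : 'I_n -> E -> R) : Prop :=
  lacunary_system Phi mu f /\
  forall (d' : measure_display) (E' : measurableType d')
    (mu' : probability E' R) (h : 'I_n -> E' -> R),
  lacunary_system Phi mu' h ->
  lacunary_constant Phi mu f <= lacunary_constant Phi mu' h.

Section least_constant.
Context {R : realType} (Phi : R -> R).
Context {d : measure_display} {E : measurableType d} (mu : probability E R).

Lemma lincomb_Lfun n (f : 'I_n -> E -> R) (a : 'I_n -> R) :
  (forall k, f k \in Lfun mu 2%:E) -> lincomb f a \in Lfun mu 2%:E.
Proof.
move=> fL; have le12 : (1 <= 2%:E :> \bar R)%E by rewrite lee_fin ler1n.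
have [L0 Lsub] := Lfun_submod_closed mu le12.
have -> : lincomb f a = \sum_(k < n) a k *: f k.
  by apply/funext => x; rewrite /lincomb fct_sumE.
elim/big_ind: _ => // [g h gL hL|k _].
  by rewrite -[g]scale1r; exact: Lsub.
by rewrite -[_ *: _]addr0; exact: Lsub.
Qed.

Lemma L2_norm_ge0 (f : E -> R) : 0 <= L2_norm mu f.
Proof. by rewrite fine_ge0// Lnorm_ge0. Qed.

Lemma L2_norm_eq0 (f : E -> R) : f \in Lfun mu 2%:E -> L2_norm mu f = 0 ->
  f = cst 0 %[ae mu].
Proof.
move=> /andP[/set_mem/= mf /set_mem/= fnf] f0.
have : ('N[mu]_2%:E[EFin \o f] = 0)%E.
  rewrite -[LHS]fineK; last by rewrite ge0_fin_numE// Lnorm_ge0.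
  by move: f0; rewrite /L2_norm => ->.
move=> /Lnorm_eq0_eq0; move/measurable_EFinP : mf => /[swap] /[apply].
by move=> /(_ (ltr0Sn _ 1)); apply: filterS => x /(_ I) [].
Qed.

Lemma lacunary_constantP n (f : 'I_n -> E -> R) : (0 < n)%N ->
  lacunary_system Phi mu f ->
  lacunary_bounds Phi mu f (lacunary_constant Phi mu f) /\
  lbound (lacunary_bounds Phi mu f) (lacunary_constant Phi mu f).
Proof.
case: n f => // n f _ [_ fL find bnd].
have le_inf a : 0 < L2_norm mu (lincomb f a) ->
    lbound (lacunary_bounds Phi mu f)
      (Luxemburg_norm Phi mu (lincomb f a) / L2_norm mu (lincomb f a)).
  by move=> a0 M /(_ a); rewrite ler_pdivrMr.
have gt0 a : L2_norm mu (lincomb f a) = 0 \/ 0 < L2_norm mu (lincomb f a).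
  by have := L2_norm_ge0 (lincomb f a); rewrite le_eqVlt => /orP[/eqP|]; auto.
have hlb : has_lbound (lacunary_bounds Phi mu f).
  have [/(L2_norm_eq0 (lincomb_Lfun (fun=> 1) fL))/find/(_ ord0)/eqP|a0] :=
    gt0 (fun=> 1); first by rewrite oner_eq0.
  by eexists; exact: le_inf a0.
split=> [a|M]; last exact: ge_inf.
have [a0|a0] := gt0 a.
  by have [M /(_ a)] := bnd; rewrite a0 !mulr0.
by rewrite -ler_pdivrMr//; apply: lb_le_inf => //; exact: le_inf.
Qed.

End least_constant.

Definition sphere (R : realType) (n : nat) : set 'rV[R]_n :=
  [set x | \sum_(k < n) x ord0 k ^+ 2 = 1].
Arguments sphere : clear implicits.

Section unit_sphere.
Context {R : realType} {n : nat}.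

Lemma sphere_delta (k : 'I_n) : (delta_mx ord0 k : 'rV[R]_n) \in sphere R n.
Proof.
apply/mem_set; rewrite /sphere/= (bigD1 k)//= mxE !eqxx expr1n big1 ?addr0//.
by move=> j /negbTE jk; rewrite mxE jk expr0n.
Qed.

Lemma sphere_mulmx (Q : 'M[R]_n) (x : 'rV[R]_n) :
  Q *m Q^T = 1%:M -> x \in sphere R n -> x *m Q \in sphere R n.
Proof.
have sqE (y : 'rV[R]_n) : \sum_(k < n) y ord0 k ^+ 2 = (y *m y^T) ord0 ord0.
  by rewrite mxE; apply: eq_bigr => k _; rewrite mxE expr2.
move=> QQ /set_mem; rewrite /sphere/= sqE => x1; apply/mem_set.
by rewrite /sphere/= sqE trmx_mul -mulmxA (mulmxA Q) QQ mul1mx x1.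
Qed.

(* Points are row vectors, so orthogonal matrices act on the right. *)
Definition rotate (Q : 'M[R]_n) (QQ : Q *m Q^T = 1%:M) (x : sphere R n) :
    sphere R n :=
  SigSub (sphere_mulmx QQ (valP x)).

End unit_sphere.

HB.instance Definition _ (R : realType) (n : nat) :=
  isPointed.Build (sphere R n.+1) (SigSub (sphere_delta ord_max)).

(* The Borel sigma-algebra of the unit sphere of R^(n+1), for the topology
   induced by R^(n+1); shifting the dimension keeps the sphere nonempty. *)
Definition borel_sphere (R : realType) (n : nat) :=
  g_sigma_algebraType (@open (sphere R n.+1)).

Section borel_sphere.
Context {R : realType} {n : nat}.

Definition direction_cosine (k : 'I_n.+1) (s : borel_sphere R n) : R :=
  (set_val (s : sphere R n.+1) : 'rV[R]_n.+1) ord0 k.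

(* Invariance under the whole orthogonal group O(n+1). By uniqueness of the
   invariant probability on a homogeneous space, exactly one sigma satisfies
   this: the normalized surface measure (the uniform measure on {-1, 1} in
   dimension 1, where invariance under SO(1) alone would say nothing). *)
Definition rotation_invariant (sigma : probability (borel_sphere R n) R) :
    Prop :=
  forall (Q : 'M[R]_n.+1) (QQ : Q *m Q^T = 1%:M) (A : set (borel_sphere R n)),
  measurable A -> sigma (rotate QQ @^-1` A) = sigma A.

End borel_sphere.

(* Main.v *)
Require Import Defs.
From mathcomp Require Import all_boot all_order all_algebra.
From mathcomp Require Import all_classical all_reals all_analysis.
From mathcomp Require Import measurable_realfun ring lra.

Import Order.TTheory GRing.Theory Num.Theory.
Import numFieldTopology.Exports numFieldNormedType.Exports.

Local Open Scope classical_set_scope.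
Local Open Scope ring_scope.

(** Let [N = n.+1] and [K] be the Luxemburg norm of a direction cosine.

    By rotation invariance, the linear form with coefficients [a] on the sphere
    has the law of [|a|] times the last coordinate ([integral_linear_form]): an
    orthogonal matrix, obtained from a Householder reflection, carries one to
    the other. Hence its Luxemburg norm is at most [|a| K], and its [L^2] norm
    is [|a| / sqrt N], since the squares of the coordinates have the same mean
    and add up to 1. So [K sqrt N] is a lacunary bound of the direction cosines.

    No system [h] has a smaller lacunary bound [M]
    ([lacunary_bound_lower_bound]). The bound concerns only the span of [h],
    which can be given an orthonormal basis [g] in [L^2]. For [M' > M] and every
    point [s] of the sphere, the integral of [Phi (|sum_k s_k g_k| / M')] is then
    at most 1. Average this over [s], exchange the integrals and apply rotation
    invariance at each fixed [x]: with [T = sum_k g_k ^ 2], of mean [N], the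
    double integral of [Phi (sqrt (T x) |s_N| / M')] is at most 1. As
    [Phi o sqrt] is convex, Jensen's inequality in [x] ([jensen_ge0]) bounds it
    from below by the integral of [Phi (sqrt N |s_N| / M')], so that
    [K <= M' / sqrt N]. *)

(** * Linear algebra *)

(** The Euclidean norm of a finite family; families, rather than row vectors,
    serve both as coefficients of [lincomb] and as rows [v ord0]. *)
Definition euclid {R : rcfType} {n : nat} (a : 'I_n -> R) : R :=
  Num.sqrt (\sum_(k < n) a k ^+ 2).

Section linear_algebra.
Context {R : rcfType}.

Lemma sumr_sqr_ge0 n (a : 'I_n -> R) : 0 <= \sum_(k < n) a k ^+ 2.
Proof. by apply: sumr_ge0 => k _; exact: sqr_ge0. Qed.

Lemma sqr_euclid n (a : 'I_n -> R) : euclid a ^+ 2 = \sum_(k < n) a k ^+ 2.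
Proof. by rewrite sqr_sqrtr// sumr_sqr_ge0. Qed.

Lemma euclid_ge0 n (a : 'I_n -> R) : 0 <= euclid a.
Proof. exact: sqrtr_ge0. Qed.

Lemma euclid_eq0 n (a : 'I_n -> R) : euclid a = 0 -> forall k, a k = 0.
Proof.
move=> a0 k; have := sqr_euclid n a; rewrite a0 expr0n => /esym/psumr_eq0P.
move=> /(_ (fun k _ => sqr_ge0 (a k)))/(_ k isT)/eqP.
by rewrite sqrf_eq0 => /eqP.
Qed.

Lemma euclid_delta n (k : 'I_n) : euclid (fun i => (i == k)%:R : R) = 1.
Proof.
rewrite /euclid (bigD1 k)//= eqxx expr1n big1 ?addr0 ?sqrtr1// => i /negbTE ->.
by rewrite expr0n.
Qed.

Lemma row_sqrE n (v : 'rV[R]_n) :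
  (v *m v^T) ord0 ord0 = \sum_(k < n) v ord0 k ^+ 2.
Proof. by rewrite mxE; apply: eq_bigr => k _; rewrite mxE expr2. Qed.

(** The orthogonal matrix is the Householder reflection exchanging [u] and the
    last vector of the canonical basis. *)
Lemma householder_unit n (u : 'rV[R]_n.+1) : u *m u^T = 1%:M ->
  exists2 Q : 'M[R]_n.+1, Q *m Q^T = 1%:M & delta_mx ord0 ord_max *m Q^T = u.
Proof.
move=> u1; pose e : 'rV[R]_n.+1 := delta_mx ord0 ord_max.
have e1 : e *m e^T = 1%:M.
  rewrite /e trmx_delta mul_delta_mx; apply/matrixP => i j.
  by rewrite !ord1 !mxE.
have [c cE] : exists c, e *m u^T = c%:M.
  by exists ((e *m u^T) ord0 ord0); exact: mx11_scalar.
have cE' : u *m e^T = c%:M by rewrite -[u]trmxK -trmx_mul cE tr_scalar_mx.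
have [w wE] : exists w, w = u - e by exists (u - e).
have ww : w *m w^T = (2 - 2 * c)%:M.
  rewrite wE linearB/= mulmxBl !mulmxBr u1 e1 cE cE' -!raddfB/=.
  by congr (_ %:M); ring.
have ew : e *m w^T = (c - 1)%:M by rewrite wE linearB/= mulmxBr e1 cE -raddfB.
(* For [w = 0] the coefficient [2 / 0 = 0] yields the identity matrix. *)
pose s := 2 - 2 * c; pose Q := 1%:M - (2 / s) *: (w^T *m w).
have QT : Q^T = Q.
  by rewrite /Q linearB/= linearZ/= trmx_mul trmxK tr_scalar_mx.
have w0 : s = 0 -> w = 0.
  move=> s0; move: ww; rewrite -/s s0 => /matrixP/(_ ord0 ord0).
  rewrite row_sqrE mxE eqxx/= => w0; apply/rowP => k; rewrite [RHS]mxE.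
  by apply: (euclid_eq0 _ (w ord0)); rewrite /euclid w0 sqrtr0.
exists Q; rewrite QT /Q.
  rewrite mulmxBl !mulmxBr !mulmx1 !mul1mx -scalemxAl -scalemxAr.
  rewrite mulmxA -(mulmxA w^T) ww -/s mul_mx_scalar -!scalemxAl !scalerA.
  rewrite opprB -addrA [X in _ + X](_ : _ = 0) ?addr0//.
  have [/w0 ->|s0] := eqVneq s 0.
    by rewrite mulmx0 !scaler0 oppr0 !addr0.
  rewrite -scaleNr -!scalerDl; apply/eqP; rewrite scaler_eq0.
  by apply/orP; left; apply/eqP; field.
rewrite mulmxBr mulmx1 -scalemxAr mulmxA ew mul_scalar_mx scalerA.
have [/[dup] /w0 we s0|s0] := eqVneq s 0.
  by rewrite we !scaler0 subr0; apply/esym/eqP; rewrite -subr_eq0 -wE we.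
have -> : 2 / s * (c - 1) = -1 by move: s0; rewrite /s => s0; field.
by rewrite scaleN1r opprK wE addrC subrK.
Qed.

(** Up to an orthogonal change of variable, a linear form is its norm times the
    last coordinate. *)
Lemma householder n (v : 'rV[R]_n.+1) :
  exists2 Q : 'M[R]_n.+1, Q *m Q^T = 1%:M &
    forall x : 'rV[R]_n.+1,
      \sum_(k < n.+1) v ord0 k * x ord0 k =
      euclid (v ord0) * (x *m Q) ord0 ord_max.
Proof.
have [v0|v0] := eqVneq (euclid (v ord0)) 0.
  exists 1%:M => [|x]; first by rewrite trmx1 mul1mx.
  by rewrite v0 mul0r big1// => k _; rewrite (euclid_eq0 _ _ v0) mul0r.
pose r := euclid (v ord0); have [|Q QQ Qe] := @householder_unit n (r^-1 *: v).
  rewrite linearZ/= -scalemxAl -scalemxAr scalerA (mx11_scalar (v *m v^T)).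
  rewrite row_sqrE -(sqr_euclid _ (v ord0)) -/r scale_scalar_mx.
  by congr (_ %:M); field.
exists Q => // x; transitivity ((x *m v^T) ord0 ord0).
  by rewrite mxE; apply: eq_bigr => k _; rewrite mxE mulrC.
have -> : v^T = r *: (Q *m delta_mx ord_max ord0).
  rewrite -[Q]trmxK -trmx_delta -trmx_mul Qe linearZ/=.
  by rewrite scalerA divff// scale1r.
by rewrite -scalemxAr mulmxA -colE !mxE.
Qed.

(** A positive definite symmetric matrix is congruent to the identity: the
    induction clears the first row and column and passes to the Schur
    complement. *)
Lemma posdef_congruent1 n (G : 'M[R]_n) : G^T = G ->
  (forall u : 'rV[R]_n, u != 0 -> 0 < (u *m G *m u^T) ord0 ord0) ->
  exists B : 'M[R]_n, B *m G *m B^T = 1%:M.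
Proof.
elim: n G => [|n IH] G sG pG.
  by exists 0; apply/matrixP => -[].
move: G sG pG; rewrite -[n.+1]/(1 + n)%N => G sG pG.
pose g := G ord0 ord0; pose v := ursubmx G; pose H := drsubmx G.
have GE : G = block_mx g%:M v v^T H.
  rewrite -[LHS]submxK; congr block_mx; last by rewrite -{1}sG trmx_ursub.
  by rewrite [LHS]mx11_scalar !mxE !lshift0.
have sH : H^T = H by rewrite /H trmx_drsub sG.
have g0 : 0 < g.
  have := pG (delta_mx ord0 ord0).
  rewrite trmx_delta -rowE -colE !mxE; apply.
  by apply/eqP => /rowP/(_ ord0); rewrite !mxE eqxx => /eqP; rewrite oner_eq0.
pose S := H - g^-1 *: (v^T *m v).
have [||B' B'S] := IH S.
- by rewrite /S linearB/= linearZ/= trmx_mul trmxK sH.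
- move=> u u0.
  (* The first entry is the one minimising the quadratic form of [G] at fixed
     [u], the minimum being that of [S]. *)
  have := pG (row_mx (- g^-1 *: (u *m v^T)) u).
  rewrite GE mul_row_block tr_row_mx mul_row_col.
  rewrite -!scalemxAl mul_mx_scalar scalerA mulNr mulVf ?gt_eqF//.
  rewrite scaleN1r addNr mul0mx add0r.
  have -> : - g^-1 *: (u *m v^T *m v) + u *m H = u *m S.
    by rewrite scaleNr addrC -mulmxA scalemxAr -mulmxBr.
  apply.
  by apply: contra_neq u0 => /(congr1 rsubmx); rewrite row_mxKr linear0.
pose B := block_mx (Num.sqrt g)^-1%:M 0 (- g^-1 *: (B' *m v^T)) B'.
exists B; rewrite GE /B tr_block_mx !mulmx_block trmx0 !mul0mx !addr0.
rewrite !mulmx0 !addr0 [RHS]scalar_mx_block.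
have z1 : - g^-1 *: (B' *m v^T) *m g%:M + B' *m v^T = 0.
  by rewrite mul_mx_scalar scalerA mulrN divff ?gt_eqF// scaleN1r addNr.
rewrite z1 !mul0mx add0r; congr block_mx.
- rewrite tr_scalar_mx -!scalar_mxM; apply/matrixP => i j; rewrite !ord1 !mxE.
  rewrite -[X in _ * X * _](sqr_sqrtr (ltW g0)) expr2 mulrA mulVf ?mul1r ?divff//;
    by rewrite gt_eqF// sqrtr_gt0.
- rewrite linearZ/= trmx_mul trmxK -!mulmxA -mulmxDr.
  rewrite [g%:M *m _]mul_scalar_mx scalerA mulrN divff ?gt_eqF//.
  rewrite scaleN1r addNr mulmx0.
- by [].
rewrite -scalemxAl -mulmxA scalemxAr -mulmxDr.
by rewrite scaleNr addrC; exact: B'S.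
Qed.

End linear_algebra.

(** * Convex functions *)

Section convexity.
Context {R : realType}.

Lemma convex_functionE (D : set R^o) (f : R -> R) (t x y : R) :
  convex_function D f -> 0 <= t -> t <= 1 -> D x -> D y ->
  f (t * x + (1 - t) * y) <= t * f x + (1 - t) * f y.
Proof.
by move=> cf t0 t1 Dx Dy; have := cf (Itv01 t0 t1) x y (mem_set Dx) (mem_set Dy).
Qed.

(** The slope [c] is the supremum of the slopes of the chords ending at [t0]
    from the left; it is nonnegative because of the chord from [0]. *)
Lemma convex_supporting_line (f : R -> R) (t0 : R) :
  convex_function (`[0, +oo[%classic : set R^o) f -> f 0 = 0 ->
  (forall t, 0 <= t -> 0 <= f t) -> 0 < t0 ->
  exists2 c, 0 <= c & forall t, 0 <= t -> f t0 + c * t <= f t + c * t0.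
Proof.
move=> cf f0 f_ge0 t0_gt0.
have half (x : R) : 0 <= x -> `[0, +oo[%classic x.
  by move=> x0; rewrite /= in_itv/= x0.
have chord s t : 0 <= s -> s < t0 -> t0 < t ->
    (f t0 - f s) / (t0 - s) <= (f t - f t0) / (t - t0).
  move=> s0 st0 t0t; have ts : 0 < t - s by rewrite subr_gt0 (lt_trans st0).
  have t00 : 0 <= t by rewrite (le_trans _ (ltW t0t))// ltW.
  have l0 : 0 <= (t - t0) / (t - s) by rewrite divr_ge0// ltW// subr_gt0.
  have l1 : (t - t0) / (t - s) <= 1.
    by rewrite ler_pdivrMr// mul1r lerD2l lerN2 ltW.
  have := convex_functionE _ _ _ s t cf l0 l1 (half _ s0) (half _ t00).
  have -> : (t - t0) / (t - s) * s + (1 - (t - t0) / (t - s)) * t = t0.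
    by field; rewrite gt_eqF.
  have -> : (t - t0) / (t - s) * f s + (1 - (t - t0) / (t - s)) * f t =
     ((t - t0) * f s + (t0 - s) * f t) / (t - s) by field; rewrite gt_eqF.
  rewrite ler_pdivlMr// => h.
  rewrite ler_pdivrMr ?subr_gt0// mulrAC ler_pdivlMr ?subr_gt0//.
  lra.
pose S := [set (f t0 - f s) / (t0 - s) | s in `[0, t0[%classic].
have S0 : S (f t0 / t0).
  by exists 0; rewrite /= ?in_itv/= ?lexx ?t0_gt0// f0 !subr0.
have ubS t : t0 < t -> ubound S ((f t - f t0) / (t - t0)).
  by move=> t0t y [s /=]; rewrite in_itv/= => /andP[s0 st] <-; exact: chord.
have supS : has_sup S.
  split; first by exists (f t0 / t0).
  by exists ((f (t0 + 1) - f t0) / (t0 + 1 - t0)); apply: ubS; rewrite ltrDl.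
exists (sup S) => [|t t_ge0].
  apply: (@le_trans _ _ (f t0 / t0)); last exact: (sup_upper_bound supS).
  by rewrite divr_ge0// ?f_ge0// ltW.
have [tt0|t0t|->] := ltgtP t t0; last by [].
- have : (f t0 - f t) / (t0 - t) <= sup S.
    by apply: sup_upper_bound => //; exists t => //=; rewrite in_itv/= t_ge0.
  by rewrite ler_pdivrMr ?subr_gt0// => h; lra.
- have : sup S <= (f t - f t0) / (t - t0).
    by apply: ge_sup; [exists (f t0 / t0)|exact: ubS].
  by rewrite ler_pdivlMr ?subr_gt0// => h; lra.
Qed.

Lemma N_function_scale (Phi : R -> R) (t u : R) :
  N_function Phi -> 0 <= t -> t <= 1 -> Phi (t * u) <= t * Phi u.
Proof.
move=> hPhi t0 t1.
have := convex_functionE _ _ t u 0 (N_function_convex hPhi) t0 t1 I I.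
by rewrite mulr0 addr0 (N_function0 hPhi) mulr0 addr0.
Qed.

Lemma N_function_le (Phi : R -> R) (u v : R) :
  N_function Phi -> 0 <= u -> u <= v -> Phi u <= Phi v.
Proof.
move=> hPhi u0 uv; have [v0|v0] := eqVneq v 0.
  by have -> : u = v by apply/eqP; rewrite eq_le uv v0.
have v_gt0 : 0 < v by rewrite lt_neqAle eq_sym v0 (le_trans u0 uv).
rewrite -[u](divfK v0).
apply: le_trans (N_function_scale _ _ _ hPhi (divr_ge0 u0 (ltW v_gt0)) _) _.
  by rewrite ler_pdivrMr// mul1r.
rewrite ler_piMl ?(N_function_ge0 hPhi)//.
by rewrite ler_pdivrMr// mul1r.
Qed.

End convexity.

(** * Orlicz spaces *)

Lemma integral_probability_cst {R : realType} d (E : measurableType d)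
  (mu : probability E R) (r : R) : (\int[mu]_x r%:E = r%:E)%E.
Proof.
rewrite integral_cst// -[RHS]mule1; congr (_ * _)%E.
exact: probability_setT.
Qed.

Section orlicz.
Context {R : realType} (Phi : R -> R).
Context {d : measure_display} {E : measurableType d} (mu : probability E R).
Hypothesis hPhi : N_function Phi.

Let Phi_ge0 u : 0 <= Phi u := N_function_ge0 hPhi u.

Lemma measurable_N_function : measurable_fun [set: R] Phi.
Proof. exact: continuous_measurable_fun (N_function_continuous hPhi). Qed.

Lemma measurable_modular (f : E -> R) (l : R) : measurable_fun setT f ->
  measurable_fun setT (fun x => (Phi (`|f x| / l))%:E).
Proof.
move=> mf; apply/measurable_EFinP.
apply: (measurableT_comp measurable_N_function).
by apply: measurable_funM => //; exact: measurableT_comp.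
Qed.

Lemma modular_le (f : E -> R) (l l' : R) : measurable_fun setT f ->
  0 < l -> l <= l' ->
  (\int[mu]_x (Phi (`|f x| / l'))%:E <= \int[mu]_x (Phi (`|f x| / l))%:E)%E.
Proof.
move=> mf l0 ll'; apply: ge0_le_integral => //.
- by move=> x _; rewrite lee_fin.
- exact: measurable_modular.
- exact: measurable_modular.
move=> x _; rewrite lee_fin; apply: N_function_le => //.
  by rewrite divr_ge0// (le_trans (ltW l0)).
by rewrite ler_wpM2l// lef_pV2// posrE// (lt_le_trans l0).
Qed.

(** A finite modular can be brought below 1 by enlarging the scale, because
    [Phi (u / N) <= Phi u / N] for [1 <= N]. *)
Lemma Orlicz_modular_le1 (f : E -> R) : Orlicz_space Phi mu f ->
  exists2 l, 0 < l & (\int[mu]_x (Phi (`|f x| / l))%:E <= 1)%E.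
Proof.
move=> [mf [l l0 fin]]; set I := integral _ _ _ in fin.
have I0 : (0 <= I)%E by apply: integral_ge0 => x _; rewrite lee_fin.
have If : I \is a fin_num by rewrite ge0_fin_numE.
pose N := 1 + fine I; have N1 : 1 <= N by rewrite lerDl fine_ge0.
have N0 : 0 < N by rewrite (lt_le_trans ltr01).
exists (l * N); first exact: mulr_gt0.
apply: (@le_trans _ _ (\int[mu]_x (N^-1%:E * (Phi (`|f x| / l))%:E))%E).
  apply: ge0_le_integral => //.
  - by move=> x _; rewrite lee_fin.
  - exact: measurable_modular.
  - by apply: measurable_funeM; exact: measurable_modular.
  move=> x _; rewrite -EFinM lee_fin invfM mulrA [_ / N]mulrC.
  by apply: N_function_scale => //; rewrite ?invr_ge0 ?invf_le1// ltW.
rewrite ge0_integralZl//.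
- rewrite -/I -(fineK If) -EFinM lee_fin mulrC ler_pdivrMr// mul1r.
  by rewrite /N lerDr.
- exact: measurable_modular.
- by move=> x _; rewrite lee_fin.
- by rewrite lee_fin invr_ge0 ltW.
Qed.

Lemma OrliczD (f g : E -> R) : Orlicz_space Phi mu f -> Orlicz_space Phi mu g ->
  Orlicz_space Phi mu (fun x => f x + g x).
Proof.
move=> [mf [l l0 fl]] [mg [m m0 gm]]; split; first exact: measurable_funD.
have lm0 : 0 < l + m by rewrite addr_gt0.
exists (l + m) => //.
pose t := l / (l + m).
have t0 : 0 <= t by rewrite divr_ge0// ltW.
have t1 : t <= 1 by rewrite ler_pdivrMr// mul1r lerDl ltW.
have s0 : 0 <= 1 - t by rewrite subr_ge0.
apply: (@le_lt_trans _ _ (\int[mu]_x (t%:E * (Phi (`|f x| / l))%:E +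
    (1 - t)%:E * (Phi (`|g x| / m))%:E))%E).
  apply: ge0_le_integral => //.
  - by move=> x _; rewrite lee_fin.
  - by apply: measurable_modular; exact: measurable_funD.
  - by apply: emeasurable_funD; apply: measurable_funeM; exact: measurable_modular.
  move=> x _; rewrite -!EFinM -EFinD lee_fin.
  apply: le_trans (convex_functionE _ _ _ _ _ (N_function_convex hPhi) t0 t1 I I).
  apply: N_function_le => //; first by rewrite divr_ge0// ltW.
  have -> : t * (`|f x| / l) + (1 - t) * (`|g x| / m) = (`|f x| + `|g x|) / (l + m).
    by rewrite /t; field; rewrite !gt_eqF.
  by rewrite ler_wpM2r ?ler_normD// invr_ge0 ltW.
rewrite ge0_integralD//.
- rewrite !ge0_integralZl//; last 4 first.
  + exact: measurable_modular.
  + by move=> x _; rewrite lee_fin.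
  + exact: measurable_modular.
  + by move=> x _; rewrite lee_fin.
  by rewrite lte_add_pinfty// lte_mul_pinfty// lee_fin.
- by move=> x _; rewrite -EFinM lee_fin mulr_ge0.
- by apply: measurable_funeM; exact: measurable_modular.
- by move=> x _; rewrite -EFinM lee_fin mulr_ge0.
- by apply: measurable_funeM; exact: measurable_modular.
Qed.

Lemma OrliczZ (c : R) (f : E -> R) : Orlicz_space Phi mu f ->
  Orlicz_space Phi mu (fun x => c * f x).
Proof.
move=> [mf [l l0 fl]]; split; first exact: measurable_funM.
have [->|c0] := eqVneq c 0.
  exists 1 => //; under eq_integral do rewrite mul0r normr0 mul0r (N_function0 hPhi).
  by rewrite integral0.
exists (`|c| * l); first by rewrite mulr_gt0 ?normr_gt0.
by under eq_integral do rewrite normrM -mulf_div divff ?normr_eq0// mul1r.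
Qed.

Lemma Orlicz_lincomb n (f : 'I_n -> E -> R) (a : 'I_n -> R) :
  (forall k, Orlicz_space Phi mu (f k)) -> Orlicz_space Phi mu (lincomb f a).
Proof.
move=> fO; have -> : lincomb f a = \sum_(k < n) (fun x => a k * f k x).
  by apply/funext => x; rewrite /lincomb fct_sumE.
elim/big_ind: _ => [|g h gO hO|k _].
- split; first exact: measurable_cst.
  exists 1 => //; under eq_integral do rewrite normr0 mul0r (N_function0 hPhi).
  by rewrite integral0.
- exact: OrliczD.
- exact: OrliczZ.
Qed.

Lemma Orlicz_bounded (f : E -> R) (M : R) : measurable_fun setT f ->
  (forall x, `|f x| <= M) -> Orlicz_space Phi mu f.
Proof.
move=> mf fM; split => //; exists 1 => //.
apply: (@le_lt_trans _ _ (\int[mu]_x (Phi M)%:E)%E).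
  apply: ge0_le_integral => //.
  - by move=> x _; rewrite lee_fin.
  - exact: measurable_modular.
  by move=> x _; rewrite lee_fin divr1; apply: N_function_le.
by rewrite integral_probability_cst ltry.
Qed.

Lemma Luxemburg_norm_ge0 (f : E -> R) : 0 <= Luxemburg_norm Phi mu f.
Proof.
rewrite /Luxemburg_norm; have [->|/set0P S0] := eqVneq
    [set l : R | 0 < l /\ (\int[mu]_x (Phi (`|f x| / l))%:E <= 1)%E] set0.
  by rewrite inf0.
by apply: lb_le_inf => // l [/ltW].
Qed.

Lemma Luxemburg_norm_le (f : E -> R) (l : R) : 0 < l ->
  (\int[mu]_x (Phi (`|f x| / l))%:E <= 1)%E -> Luxemburg_norm Phi mu f <= l.
Proof. by move=> l0 fl; apply: ge_inf => //; exists 0 => m [/ltW]. Qed.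

Lemma modular_Luxemburg_lt (f : E -> R) (l : R) : Orlicz_space Phi mu f ->
  Luxemburg_norm Phi mu f < l -> (\int[mu]_x (Phi (`|f x| / l))%:E <= 1)%E.
Proof.
move=> fO /inf_lt[|m [m0 fm] ml].
  by have [l' l'0 fl'] := Orlicz_modular_le1 _ fO; exists l'.
by apply: le_trans fm; apply: modular_le (ltW ml) => //; case: fO.
Qed.

Lemma Luxemburg_normZ_le (c : R) (f : E -> R) : 0 <= c ->
  Orlicz_space Phi mu f ->
  Luxemburg_norm Phi mu (fun x => c * f x) <= c * Luxemburg_norm Phi mu f.
Proof.
rewrite le_eqVlt => /predU1P[<-|c0] fO.
  rewrite mul0r; apply/ler_addgt0Pl => e e0; rewrite addr0.
  apply: Luxemburg_norm_le => //.
  under eq_integral do rewrite mul0r normr0 mul0r (N_function0 hPhi).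
  by rewrite integral0.
rewrite mulrC -ler_pdivrMr//; apply: lb_le_inf => [|l [l0 fl]].
  by have [l l0 fl] := Orlicz_modular_le1 _ fO; exists l.
rewrite ler_pdivrMr// mulrC; apply: Luxemburg_norm_le; first exact: mulr_gt0.
under eq_integral do rewrite normrM (gtr0_norm c0) -mulf_div divff ?gt_eqF// mul1r.
exact: fl.
Qed.

End orlicz.

(** * Jensen's inequality *)

(** Jensen's inequality on a probability space, for a nonnegative convex
    function vanishing at 0; the right-hand side may be infinite. *)
Lemma jensen_ge0 {R : realType} d (E : measurableType d) (mu : probability E R)
    (f : R -> R) (T : E -> R) (m : R) :
  convex_function (`[0, +oo[%classic : set R^o) f -> f 0 = 0 ->
  (forall t, 0 <= t -> 0 <= f t) ->
  measurable_fun setT T -> measurable_fun setT (f \o T) ->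
  (forall x, 0 <= T x) -> (\int[mu]_x (T x)%:E = m%:E)%E ->
  ((f m)%:E <= \int[mu]_x (f (T x))%:E)%E.
Proof.
move=> cf f0 f_ge0 mT mfT T0 Tm.
have fT0 x : (0 <= (f (T x))%:E)%E by rewrite lee_fin f_ge0.
have : (0 <= m%:E)%E.
  by rewrite -Tm; apply: integral_ge0 => x _; rewrite lee_fin.
rewrite lee_fin le_eqVlt => /predU1P[<-|m0].
  by rewrite f0; exact: integral_ge0.
have [c c0 fc] := convex_supporting_line _ _ cf f0 f_ge0 m0.
have mfT' : measurable_fun setT (fun x => (f (T x))%:E) by apply/measurable_EFinP.
have mcT : measurable_fun setT (fun x => c%:E * (T x)%:E)%E.
  by apply: measurable_funeM; apply/measurable_EFinP.
have : (\int[mu]_x ((f m)%:E + c%:E * (T x)%:E) <=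
        \int[mu]_x ((f (T x))%:E + (c * m)%:E))%E.
  apply: ge0_le_integral => //.
  - move=> x _; rewrite -EFinM -EFinD lee_fin addr_ge0 ?mulr_ge0// f_ge0//.
    exact: ltW.
  - by apply: emeasurable_funD => //; exact: measurable_cst.
  - by apply: emeasurable_funD => //; exact: measurable_cst.
  - by move=> x _; rewrite -EFinM -!EFinD lee_fin; exact: fc.
rewrite ge0_integralD//; last 2 first.
- by move=> x _; rewrite lee_fin f_ge0// ltW.
- by move=> x _; rewrite -EFinM lee_fin mulr_ge0.
rewrite ge0_integralD//; last by move=> x _; rewrite lee_fin mulr_ge0// ltW.
rewrite ge0_integralZl//; last 2 first.
- by apply/measurable_EFinP.
- by move=> x _; rewrite lee_fin.
by rewrite Tm !integral_probability_cst -EFinM leeD2rE.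
Qed.

(** * Square-integrable functions *)

Section square_integrable.
Context {R : realType}.
Context {d : measure_display} {E : measurableType d} (mu : probability E R).

Lemma lincomb_delta n (f : 'I_n -> E -> R) (k : 'I_n) :
  lincomb f (fun i => (i == k)%:R) = f k.
Proof.
apply/funext => x; rewrite /lincomb (bigD1 k)//= eqxx mul1r big1 ?addr0//.
by move=> i /negbTE ->; rewrite mul0r.
Qed.

Lemma Lfun_measurable (f : E -> R) : f \in Lfun mu 2%:E -> measurable_fun setT f.
Proof. by move=> /andP[/set_mem]. Qed.

Lemma L2_norm_sqr (f : E -> R) : f \in Lfun mu 2%:E ->
  ((L2_norm mu f ^+ 2)%:E = \int[mu]_x (f x ^+ 2)%:E)%E.
Proof.
move=> /andP[_ /set_mem fin].
have Nf : ('N[mu]_2%:E[EFin \o f])%E \is a fin_num.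
  by rewrite ge0_fin_numE// Lnorm_ge0.
have two0 : (2 : R) != 0 by rewrite pnatr_eq0.
have := powR_Lnorm mu (EFin \o f) two0.
rewrite -{1}(fineK Nf) poweR_EFin powR_mulrn ?L2_norm_ge0// => ->.
by apply: eq_integral => x _; rewrite /= powR_mulrn// real_normK// num_real.
Qed.

Lemma Lfun_bounded (f : E -> R) (M : R) : measurable_fun setT f ->
  (forall x, `|f x| <= M) -> f \in Lfun mu 2%:E.
Proof.
move=> mf fM; apply/andP; split; first exact/mem_set.
apply/mem_set; rewrite /= /finite_norm unlock poweR_lty//.
apply: (@le_lt_trans _ _ (\int[mu]_x (M `^ 2)%:E)%E); last first.
  by rewrite integral_probability_cst ltry.
apply: ge0_le_integral => //.
- by move=> x _; exact: poweR_ge0.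
- apply: (measurableT_comp (measurable_poweR _)).
  by apply: measurableT_comp => //; apply/measurable_EFinP.
- move=> x _ /=; rewrite lee_fin ge0_ler_powR ?nnegrE//.
  exact: le_trans (fM x).
Qed.

(** Orthonormalisation in [L^2]: the Gram matrix of an independent system is
    positive definite, hence congruent to the identity. *)
Lemma L2_orthonormalization n (h : 'I_n -> E -> R) :
  (forall k, h k \in Lfun mu 2%:E) -> ae_linearly_independent mu h ->
  exists B : 'M[R]_n, forall a : 'I_n -> R,
    L2_norm mu (lincomb h (fun j => \sum_(k < n) a k * B k j)) = euclid a.
Proof.
move=> hL hind.
have hhI i j : mu.-integrable setT (EFin \o (fun x => h i x * h j x)).
  by apply/Lfun1_integrable; exact: Lfun2_mul_Lfun1.
pose G : 'M[R]_n := \matrix_(i, j) Rintegral mu setT (fun x => h i x * h j x).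
have GE (a : 'rV[R]_n) :
    L2_norm mu (lincomb h (a ord0)) ^+ 2 = (a *m G *m a^T) ord0 ord0.
  apply: EFin_inj; rewrite L2_norm_sqr; last exact: lincomb_Lfun.
  transitivity (\int[mu]_x \sum_(i < n) \sum_(j < n)
      ((a ord0 i * a ord0 j)%:E * (h i x * h j x)%:E))%E.
    apply: eq_integral => x _; rewrite /lincomb expr2 mulr_suml.
    rewrite -sumEFin; apply: eq_bigr => i _.
    rewrite mulr_sumr -sumEFin; apply: eq_bigr => j _.
    by rewrite -EFinM; congr (_ %:E); ring.
  have aI i j : mu.-integrable setT
      (fun x => (a ord0 i * a ord0 j)%:E * (h i x * h j x)%:E)%E.
    exact: (integrableZl measurableT (a ord0 i * a ord0 j) (hhI i j)).
  rewrite integral_sum//; last by move=> i; exact: integrable_sum.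
  rewrite -mulmxA mxE -sumEFin; apply: eq_bigr => i _.
  rewrite (integral_sum _ (aI i))// mxE mulr_sumr -sumEFin; apply: eq_bigr => j _.
  rewrite (integralZl _ (hhI i j))// !mxE -(fineK (integrable_fin_num measurableT (hhI i j))).
  by rewrite -EFinM; congr (_ %:E); rewrite /Rintegral/=; ring.
have [||B BG] := posdef_congruent1 _ G.
- apply/matrixP => i j; rewrite !mxE; congr Rintegral.
  by apply/funext => x; rewrite mulrC.
- move=> u u0; rewrite -GE exprn_gt0// lt_neqAle L2_norm_ge0 andbT eq_sym.
  apply: contra_neq u0 => /L2_norm_eq0 u0; apply/rowP => k; rewrite mxE.
  by apply: hind; apply: u0; exact: lincomb_Lfun.
exists B => a; pose r : 'rV[R]_n := \row_k a k.
have -> : (fun j => \sum_(k < n) a k * B k j) = (r *m B) ord0.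
  by apply/funext => j; rewrite mxE; apply: eq_bigr => k _; rewrite mxE.
apply/eqP; rewrite -(@eqrXn2 _ 2)// ?L2_norm_ge0 ?euclid_ge0//.
rewrite GE trmx_mul mulmxA -(mulmxA r) -(mulmxA r) BG mulmx1 row_sqrE sqr_euclid.
by apply/eqP; apply: eq_bigr => k _; rewrite mxE.
Qed.

End square_integrable.

(** * The unit sphere *)

Section sphere_measurability.
Context {R : realType}.

Lemma row_continuous (T : topologicalType) m (f : T -> 'rV[R]_m) :
  (forall k, continuous (fun x => f x ord0 k)) -> continuous f.
Proof.
move=> cf x P [Q Qf QP]; rewrite /nbhs/=.
suff : \forall y \near x, forall k, Q ord0 k (f y ord0 k).
  by apply: filterS => y Qy; apply: QP => i k; rewrite ord1.
by apply: filter_forall => k; apply: (cf k x); exact: Qf.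
Qed.

Lemma row_mulmx_continuous (T : topologicalType) m (f : T -> 'rV[R]_m)
    (Q : 'M[R]_m) :
  (forall k, continuous (fun x => f x ord0 k)) ->
  continuous (fun x => f x *m Q).
Proof.
move=> cf; apply: row_continuous => k.
rewrite (_ : (fun _ => _) = fun x => \sum_(j < m) f x ord0 j * Q j k); last first.
  by apply/funext => x; rewrite mxE.
elim: (index_enum 'I_m) => [|j s IH].
  by under eq_fun do rewrite big_nil; exact: cst_continuous.
under eq_fun do rewrite big_cons.
by move=> x; apply: cvgD; [apply: cvgMr_tmp; exact: cf|exact: IH].
Qed.

Context {n : nat}.

Lemma sphere_coord_continuous (k : 'I_n.+1) :
  continuous (fun x : sphere R n.+1 => (set_val x : 'rV[R]_n.+1) ord0 k).
Proof.
move=> x; apply: (@continuous_comp _ _ _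
  (set_val : sphere R n.+1 -> 'rV[R]_n.+1) (fun y => y ord0 k)).
- exact: initial_continuous.
- exact: coord_continuous.
Qed.

Lemma measurable_direction_cosine (k : 'I_n.+1) :
  measurable_fun setT (@direction_cosine R n k).
Proof.
apply: (measurability _ (RGenOpens.measurableE R)) => _ [_ [a [b ->] <-]].
rewrite setTI; apply: sub_sigma_algebra.
by have /continuousP := sphere_coord_continuous k; apply; exact: interval_open.
Qed.

Lemma measurable_rotate (Q : 'M[R]_n.+1) (QQ : Q *m Q^T = 1%:M) :
  measurable_fun setT (rotate QQ : borel_sphere R n -> borel_sphere R n).
Proof.
have cQ : continuous (rotate QQ).
  apply: continuous_comp_initial.
  apply: (row_mulmx_continuous _ _ (set_val : sphere R n.+1 -> 'rV[R]_n.+1)).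
  exact: sphere_coord_continuous.
apply: (@measurability _ _ (borel_sphere R n) (borel_sphere R n) setT
  (rotate QQ) (@open (sphere R n.+1))) => // _ [A oA <-].
rewrite setTI; apply: sub_sigma_algebra.
by move/continuousP : cQ; apply; exact: oA.
Qed.

Lemma sum_sqr_direction_cosine (s : borel_sphere R n) :
  \sum_(k < n.+1) direction_cosine k s ^+ 2 = 1.
Proof. by have /set_mem := valP (s : sphere R n.+1). Qed.

Lemma euclid_direction_cosine (s : borel_sphere R n) :
  euclid (direction_cosine^~ s) = 1.
Proof. by rewrite /euclid sum_sqr_direction_cosine sqrtr1. Qed.

Lemma direction_cosine_le1 (k : 'I_n.+1) (s : borel_sphere R n) :
  `|direction_cosine k s| <= 1.
Proof.
rewrite -(@ler_pXn2r _ 2)// ?nnegrE// expr1n real_normK ?num_real//.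
rewrite -(sum_sqr_direction_cosine s) (bigD1 k)//= lerDl.
by apply: sumr_ge0 => j _; exact: sqr_ge0.
Qed.

End sphere_measurability.

Section rotation_invariance.
Context {R : realType} {n : nat} (sigma : probability (borel_sphere R n) R).
Hypothesis sigma_inv : rotation_invariant sigma.

Lemma ge0_integral_rotate (Q : 'M[R]_n.+1) (QQ : Q *m Q^T = 1%:M)
    (f : borel_sphere R n -> \bar R) :
  measurable_fun setT f -> (forall s, 0 <= f s)%E ->
  (\int[sigma]_s f (rotate QQ s) = \int[sigma]_s f s)%E.
Proof.
move=> mf f0.
have := ge0_integral_pushforward (measurable_rotate _ QQ) sigma measurableT mf
  (fun s _ => f0 s).
rewrite preimage_setT => <-; apply: eq_measure_integral; first exact: measurable_rotate.
by move=> mQ A mA _; exact: sigma_inv.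
Qed.

(** Under a rotation-invariant measure, the distribution of the linear form
    with coefficients [v] depends only on the Euclidean norm of [v]. *)
Lemma integral_linear_form (f : R -> R) (v : 'I_n.+1 -> R) :
  measurable_fun setT f -> (forall u, 0 <= f u) ->
  (\int[sigma]_s (f (\sum_(k < n.+1) v k * direction_cosine k s))%:E =
   \int[sigma]_s (f (euclid v * direction_cosine ord_max s))%:E)%E.
Proof.
move=> mf f0; have [Q QQ Qv] := householder _ (\row_k v k).
have vE : (\row_k v k) ord0 = v by apply/funext => k; rewrite mxE.
rewrite vE in Qv.
pose F (s : borel_sphere R n) := (f (euclid v * direction_cosine ord_max s))%:E.
rewrite -(ge0_integral_rotate _ QQ F).
- apply: eq_integral => s _; rewrite /F; congr (f _)%:E.
  exact: (Qv (set_val (s : sphere R n.+1))).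
- apply/measurable_EFinP; apply: measurableT_comp => //.
  by apply: measurable_funM => //; exact: measurable_direction_cosine.
- by move=> s; rewrite lee_fin.
Qed.

Lemma direction_cosine_Lfun (k : 'I_n.+1) :
  direction_cosine k \in Lfun sigma 2%:E.
Proof.
by apply: Lfun_bounded (direction_cosine_le1 k); exact: measurable_direction_cosine.
Qed.

(** The [n.+1] coordinates have the same second moment, and their squares add
    up to 1. *)
Lemma integral_sqr_direction_cosine (k : 'I_n.+1) :
  (\int[sigma]_s (direction_cosine k s ^+ 2)%:E = n.+1%:R^-1%:E)%E.
Proof.
have mdc j : measurable_fun setT (fun s => (@direction_cosine R n j s ^+ 2)%:E).
  apply/measurable_EFinP; apply: measurable_funX.
  exact: measurable_direction_cosine.
have E j : (\int[sigma]_s (direction_cosine j s ^+ 2)%:E =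
            \int[sigma]_s (direction_cosine ord_max s ^+ 2)%:E)%E.
  rewrite -(lincomb_delta _ (@direction_cosine R n) j).
  rewrite (integral_linear_form (fun u => u ^+ 2)); last 2 first.
  - exact: measurable_funX.
  - by move=> u; exact: sqr_ge0.
  rewrite euclid_delta.
  by under eq_integral do rewrite mul1r.
have : (\sum_(j < n.+1) \int[sigma]_s (direction_cosine j s ^+ 2)%:E = 1)%E.
  rewrite -ge0_integral_sum//.
    under eq_integral do rewrite sumEFin sum_sqr_direction_cosine.
    exact: integral_probability_cst.
  by move=> j s _; rewrite lee_fin sqr_ge0.
under eq_bigr do rewrite E.
rewrite E; set I := integral _ _ _.
have If : I \is a fin_num.
  apply: (integrable_fin_num measurableT).
  exact: Lfun2_integrable_sqr (direction_cosine_Lfun ord_max).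
rewrite -(fineK If) sumEFin sumr_const card_ord => -[I1]; congr EFin.
have n0 : n.+1%:R != 0 :> R by rewrite pnatr_eq0.
by rewrite -[LHS](mulKf n0) mulr_natl I1 mulr1.
Qed.

Lemma L2_norm_direction_cosine (a : 'I_n.+1 -> R) :
  L2_norm sigma (lincomb direction_cosine a) = euclid a / Num.sqrt n.+1%:R.
Proof.
apply/eqP; rewrite -(@eqrXn2 _ 2)// ?L2_norm_ge0 ?divr_ge0 ?sqrtr_ge0//.
apply/eqP/EFin_inj; rewrite L2_norm_sqr; last first.
  by apply: lincomb_Lfun => k; exact: direction_cosine_Lfun.
rewrite (integral_linear_form (fun u => u ^+ 2)); last 2 first.
- exact: measurable_funX.
- by move=> u; exact: sqr_ge0.
under eq_integral do rewrite exprMn EFinM.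
rewrite ge0_integralZl//; last 3 first.
- apply/measurable_EFinP; apply: measurable_funX.
  exact: measurable_direction_cosine.
- by move=> s _; rewrite lee_fin sqr_ge0.
- by rewrite lee_fin sqr_ge0.
rewrite integral_sqr_direction_cosine -EFinM expr_div_n.
by rewrite (sqr_sqrtr (ler0n _ _)).
Qed.

Lemma Luxemburg_norm_direction_cosine (Phi : R -> R) (a : 'I_n.+1 -> R) :
  N_function Phi ->
  Luxemburg_norm Phi sigma (lincomb direction_cosine a) =
  Luxemburg_norm Phi sigma (fun s => euclid a * direction_cosine ord_max s).
Proof.
move=> hPhi; rewrite /Luxemburg_norm; congr inf; apply/seteqP.
have E l : (\int[sigma]_s (Phi (`|lincomb direction_cosine a s| / l))%:E =
   \int[sigma]_s (Phi (`|euclid a * direction_cosine ord_max s| / l))%:E)%E.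
  apply: (integral_linear_form (fun u => Phi (`|u| / l))) => [|u]; last first.
    exact: N_function_ge0.
  apply: (measurableT_comp (measurable_N_function _ hPhi)).
  by apply: measurable_funM => //; exact: measurableT_comp.
by split=> l /= [l0]; rewrite E.
Qed.

End rotation_invariance.

(** * The extremal inequality *)

(** If every unit combination of functions [g k] of unit [L^2] norm has modular
    at most 1 at the scale [M], then so has the last direction cosine at the
    scale [M / sqrt n.+1]. The hypothesis is averaged over the sphere, the
    coefficients being the direction cosines of a random point. *)
Lemma sphere_average_modular_le1 {R : realType} (Phi : R -> R) n
    (sigma : probability (borel_sphere R n) R)
    d (E : measurableType d) (mu : probability E R)
    (g : 'I_n.+1 -> E -> R) (M : R) :
  N_function Phi ->
  convex_function (`[0, +oo[%classic : set R^o) (Phi \o Num.sqrt) ->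
  rotation_invariant sigma ->
  (forall k, measurable_fun setT (g k)) ->
  (forall k, (\int[mu]_x (g k x ^+ 2)%:E = 1)%E) ->
  0 < M ->
  (forall a : 'I_n.+1 -> R, euclid a = 1 ->
    (\int[mu]_x (Phi (`|lincomb g a x| / M))%:E <= 1)%E) ->
  (\int[sigma]_s
    (Phi (`|direction_cosine ord_max s| / (M / Num.sqrt n.+1%:R)))%:E <= 1)%E.
Proof.
move=> hPhi cPhi inv mg g1 M0 gM.
have Phi0 u : 0 <= Phi u := N_function_ge0 hPhi u.
have mPhi := measurable_N_function _ hPhi.
pose dc := @direction_cosine R n.
pose T x := \sum_(k < n.+1) g k x ^+ 2.
have T0 x : 0 <= T x by exact: sumr_sqr_ge0.
have mT : measurable_fun setT T.
  by apply: measurable_sum => k; exact: measurable_funX.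
have intT : (\int[mu]_x (T x)%:E = n.+1%:R%:E)%E.
  under eq_integral do rewrite -sumEFin.
  rewrite ge0_integral_sum//.
  - under eq_bigr do rewrite g1.
    by rewrite sumEFin sumr_const card_ord.
  - by move=> k; apply/measurable_EFinP; exact: measurable_funX.
  - by move=> k x _; rewrite lee_fin sqr_ge0.
have msqrt : measurable_fun setT (@Num.sqrt R).
  by apply: continuous_measurable_fun => u; exact: sqrt_continuous.
pose J (s : borel_sphere R n) x := (Phi (Num.sqrt (T x) * dc ord_max s / M))%:E.
pose L (s : borel_sphere R n) x := (Phi (lincomb g (dc^~ s) x / M))%:E.
have mdc2 k : measurable_fun setT (fun z : borel_sphere R n * E => dc k z.1).
  by apply: measurableT_comp => //; exact: measurable_direction_cosine.
have mJ : measurable_fun setT (fun z : borel_sphere R n * E => J z.1 z.2).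
  apply/measurable_EFinP; apply: (measurableT_comp mPhi).
  apply: measurable_funM => //; apply: measurable_funM => //.
  by apply: (measurableT_comp msqrt); exact: measurableT_comp.
have mL : measurable_fun setT (fun z : borel_sphere R n * E => L z.1 z.2).
  apply/measurable_EFinP; apply: (measurableT_comp mPhi).
  apply: measurable_funM => //; apply: measurable_sum => k.
  by apply: measurable_funM => //; exact: measurableT_comp.
have J0 (z : borel_sphere R n * E) : (0 <= J z.1 z.2)%E by rewrite lee_fin.
have L0 (z : borel_sphere R n * E) : (0 <= L z.1 z.2)%E by rewrite lee_fin.
have PhiN u : Phi `|u| = Phi u.
  by case: (ger0P u) => // _; rewrite (N_function_even hPhi).
have normM (u : R) : `|u| / M = `|u / M|.
  by rewrite normrM [`|M^-1|]gtr0_norm ?invr_gt0.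
(* Jensen's inequality at a fixed point of the sphere. *)
have jensen s : ((Phi (`|dc ord_max s| / (M / Num.sqrt n.+1%:R)))%:E <=
                 \int[mu]_x J s x)%E.
  pose c := `|dc ord_max s| / M.
  have c0 : 0 <= c by rewrite divr_ge0// ltW.
  have sqrtc t : Num.sqrt (c ^+ 2 * t) = c * Num.sqrt t.
    by rewrite sqrtrM ?sqr_ge0// sqrtr_sqr ger0_norm.
  have JE x : J s x = (((Phi \o Num.sqrt) (c ^+ 2 * T x))%:E).
    rewrite /J /= sqrtc -[in LHS]PhiN -normM normrM (ger0_norm (sqrtr_ge0 _)).
    by rewrite /c; congr (Phi _)%:E; ring.
  have -> : `|dc ord_max s| / (M / Num.sqrt n.+1%:R) =
      Num.sqrt (c ^+ 2 * n.+1%:R).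
    by rewrite sqrtc /c invf_div mulrA mulrAC.
  under eq_integral do rewrite JE.
  apply: (jensen_ge0 _ _ mu (Phi \o Num.sqrt) (fun x => c ^+ 2 * T x)) => //.
  - by rewrite /= sqrtr0 (N_function0 hPhi).
  - by move=> t _; exact: Phi0.
  - exact: measurable_funM.
  - apply: (measurableT_comp mPhi); apply: (measurableT_comp msqrt).
    exact: measurable_funM.
  - by move=> x; rewrite mulr_ge0// sqr_ge0.
  under eq_integral do rewrite EFinM.
  rewrite ge0_integralZl//; last 3 first.
  - exact/measurable_EFinP.
  - by move=> x _; rewrite lee_fin.
  - by rewrite lee_fin sqr_ge0.
  by rewrite intT -EFinM.
apply: (@le_trans _ _ (\int[sigma]_s \int[mu]_x J s x)%E).
  apply: ge0_le_integral => //.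
  - by move=> s _; rewrite lee_fin.
  - by apply: (measurable_modular _ hPhi); exact: measurable_direction_cosine.
  - exact: (measurable_fun_fubini_tonelli_F (m2 := mu) _ mJ J0).
rewrite (fubini_tonelli (fun z => J z.1 z.2) mJ J0)/=.
(* At a fixed [x], the linear form with coefficients [g k x] has the law of
   [sqrt (T x)] times a coordinate. *)
rewrite (eq_integral (fun x => \int[sigma]_s L s x)%E); last first.
  move=> x _; rewrite /J /L /lincomb.
  under [RHS]eq_integral do under eq_bigr do rewrite mulrC.
  apply/esym.
  apply: (integral_linear_form sigma inv (fun u => Phi (u / M)) (g^~ x)) => //.
  by apply: (measurableT_comp mPhi); exact: measurable_funM.
rewrite -(fubini_tonelli (fun z => L z.1 z.2) mL L0)/=.
rewrite -[leRHS](integral_probability_cst _ _ sigma 1).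
apply: ge0_le_integral => //.
- by move=> s _; apply: integral_ge0 => x _; rewrite lee_fin.
- exact: (measurable_fun_fubini_tonelli_F (m2 := mu) _ mL L0).
move=> s _; apply: le_trans (gM (dc^~ s) (euclid_direction_cosine s)).
rewrite le_eqVlt; apply/orP; left; apply/eqP.
by apply: eq_integral => x _; rewrite normM PhiN.
Qed.

(** The combinations of an orthonormalised system are those of [h], so they obey
    the same lacunary bounds. The modular of a function is known to be at most 1
    only strictly above its Luxemburg norm, hence the passage to [e + M]. *)
Lemma lacunary_bound_lower_bound {R : realType} (Phi : R -> R) n
    (sigma : probability (borel_sphere R n) R)
    d (E : measurableType d) (mu : probability E R)
    (h : 'I_n.+1 -> E -> R) (M : R) :
  N_function Phi ->
  convex_function (`[0, +oo[%classic : set R^o) (Phi \o Num.sqrt) ->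
  rotation_invariant sigma ->
  lacunary_system Phi mu h -> lacunary_bounds Phi mu h M ->
  Luxemburg_norm Phi sigma (direction_cosine ord_max) * Num.sqrt n.+1%:R <= M.
Proof.
move=> hPhi cPhi inv [hO hL hind _] hM.
have [B Bh] := L2_orthonormalization mu _ h hL hind.
pose g k := lincomb h (B k).
have gE a : lincomb g a = lincomb h (fun j => \sum_(k < n.+1) a k * B k j).
  apply/funext => x; rewrite /lincomb /g /lincomb.
  under eq_bigr do rewrite mulr_sumr.
  rewrite exchange_big/=; apply: eq_bigr => j _; rewrite mulr_suml.
  by apply: eq_bigr => k _; rewrite mulrA.
have gL k : g k \in Lfun mu 2%:E by exact: lincomb_Lfun.
have L2g a : L2_norm mu (lincomb g a) = euclid a by rewrite gE.
have Luxg a : Luxemburg_norm Phi mu (lincomb g a) <= M * euclid a.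
  by rewrite -L2g gE; exact: hM.
have g1 k : (\int[mu]_x (g k x ^+ 2)%:E = 1)%E.
  by rewrite -L2_norm_sqr// -(lincomb_delta _ g k) L2g euclid_delta expr1n.
have M_ge0 : 0 <= M.
  apply: le_trans (Luxemburg_norm_ge0 Phi mu (g ord0)) _.
  by rewrite -(lincomb_delta _ g ord0) (le_trans (Luxg _))// euclid_delta mulr1.
have sn : 0 < Num.sqrt n.+1%:R :> R by rewrite sqrtr_gt0.
apply/ler_addgt0Pl => e e0; rewrite -ler_pdivlMr//.
have M'0 : 0 < e + M by rewrite ltr_wpDr.
apply: Luxemburg_norm_le; first exact: divr_gt0.
apply: (@sphere_average_modular_le1 _ _ _ _ _ _ mu g) => //.
  by move=> k; exact: Lfun_measurable (gL k).
move=> a a1; apply: modular_Luxemburg_lt => //.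
  by rewrite gE; exact: Orlicz_lincomb.
by apply: le_lt_trans (Luxg a) _; rewrite a1 mulr1 ltrDr.
Qed.

Lemma direction_cosine_lacunary_bound {R : realType} (Phi : R -> R) n
    (sigma : probability (borel_sphere R n) R) :
  N_function Phi -> rotation_invariant sigma ->
  lacunary_bounds Phi sigma (@direction_cosine R n)
    (Luxemburg_norm Phi sigma (direction_cosine ord_max) * Num.sqrt n.+1%:R).
Proof.
move=> hPhi inv a; rewrite L2_norm_direction_cosine//.
rewrite Luxemburg_norm_direction_cosine//.
apply: le_trans (Luxemburg_normZ_le _ _ hPhi _ _ (euclid_ge0 _ a) _) _.
  apply: (Orlicz_bounded _ _ hPhi _ 1 _ (direction_cosine_le1 ord_max)).
  exact: measurable_direction_cosine.
rewrite mulrC le_eqVlt; apply/orP; left; apply/eqP; field.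
by rewrite sqrtr_eq0 -ltNge ltr0n.
Qed.

Lemma direction_cosine_lacunary_system {R : realType} (Phi : R -> R) n
    (sigma : probability (borel_sphere R n) R) :
  N_function Phi -> rotation_invariant sigma ->
  lacunary_system Phi sigma (@direction_cosine R n).
Proof.
move=> hPhi inv; split.
- move=> k; apply: (Orlicz_bounded _ _ hPhi _ 1 _ (direction_cosine_le1 k)).
  exact: measurable_direction_cosine.
- by move=> k; exact: direction_cosine_Lfun.
- move=> a a0; apply: euclid_eq0.
  have : L2_norm sigma (lincomb direction_cosine a) = 0.
    apply/eqP; rewrite -sqrf_eq0; apply/eqP/EFin_inj; rewrite L2_norm_sqr.
      rewrite (ae_eq_integral (cst 0)%E) ?integral0//.
      - apply/measurable_EFinP; apply: measurable_funX; apply: (Lfun_measurable sigma).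
        by apply: lincomb_Lfun => k; exact: direction_cosine_Lfun.
      - by apply: filterS a0 => s /= /(_ I) -> _; rewrite expr0n.
    by apply: lincomb_Lfun => k; exact: direction_cosine_Lfun.
  rewrite L2_norm_direction_cosine// => /eqP.
  have sn : Num.sqrt n.+1%:R != 0 :> R by rewrite gt_eqF// sqrtr_gt0.
  by rewrite mulf_eq0 invr_eq0 (negbTE sn) orbF => /eqP.
- by eexists; exact: direction_cosine_lacunary_bound.
Qed.

Theorem corollary1 (R : realType) (Phi : R -> R) (n : nat)
    (sigma : probability (borel_sphere R n) R) :
  N_function Phi ->
  convex_function (`[0, +oo[%classic : set R^o) (Phi \o Num.sqrt) ->
  rotation_invariant sigma ->
  best_lacunary_system Phi sigma (@direction_cosine R n) /\
  lacunary_constant Phi sigma (@direction_cosine R n) =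
    Luxemburg_norm Phi sigma (direction_cosine ord_max) * Num.sqrt n.+1%:R.
Proof.
move=> hPhi cPhi inv.
have lac := direction_cosine_lacunary_system _ _ _ hPhi inv.
have [Cbound Cleast] := lacunary_constantP (ltn0Sn n) lac.
have CE : lacunary_constant Phi sigma (@direction_cosine R n) =
    Luxemburg_norm Phi sigma (direction_cosine ord_max) * Num.sqrt n.+1%:R.
  apply/eqP; rewrite eq_le; apply/andP; split.
    by apply: Cleast; exact: direction_cosine_lacunary_bound.
  exact: (lacunary_bound_lower_bound _ _ _ _ _ _ _ _ hPhi cPhi inv lac).
split=> //; split=> // d E mu h hlac; rewrite CE.
apply: (lacunary_bound_lower_bound _ _ _ _ _ _ _ _ hPhi cPhi inv hlac).
by have [] := lacunary_constantP (ltn0Sn n) hlac.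
Qed.
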